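(* Let $n$ and $b=b(n)$ be positive integers with $b\le \frac{n}{\ln^2 n}$. Then in the $(1:b)$ Walker-Breaker game on $K_n$, Walker can create a cycle of length $n-O(b)$; that is, there is an absolute constant $C>0$ such that for all sufficiently large $n$ and all such $b$, Walker has a strategy to create a cycle of length at least $n-Cb$.
   Context: A $(1:b)$ Walker-Breaker game on $K_n$ is played as follows. Walker and Breaker alternately claim edges of the complete graph $K_n$. At every moment Walker has a position, a vertex $v$. In her move Walker must choose an edge $vw$ incident with her current position $v$ which has not been claimed by Breaker (it may have been claimed by Walker before); she claims this edge (if not already hers) and $w$ becomes her new position. In each of his moves Breaker claims $b$ edges not claimed by either player so far, without any further restriction. Walker creates a structure if the graph of her claimed edges contains it. *)

(* Defs.v *)
From mathcomp Require Import all_boot.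

Set Implicit Arguments.
Unset Strict Implicit.
Unset Printing Implicit Defensive.

(* An edge of K_n on the vertex set 'I_n is a two-element set of vertices. *)
Definition edges (n : nat) : {set {set 'I_n}} :=
  [set e : {set 'I_n} | #|e| == 2].

Inductive player := Walker | Breaker.

Record state (n : nat) := State {
  to_move : player;
  pos : 'I_n;
  walker_edges : {set {set 'I_n}};
  breaker_edges : {set {set 'I_n}} }.

Definition free_edges (n : nat) (s : state n) : {set {set 'I_n}} :=
  edges n :\: (walker_edges s :|: breaker_edges s).

Definition walker_legal (n : nat) (s : state n) (w : 'I_n) : bool :=
  ([set pos s; w] \in edges n) && ([set pos s; w] \notin breaker_edges s).

Definition walker_move (n : nat) (s : state n) (w : 'I_n) : state n :=
  State Breaker w ([set pos s; w] |: walker_edges s) (breaker_edges s).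

(* Breaker claims exactly b free edges, or all of them if fewer than b are
   left. *)
Definition breaker_legal (n b : nat) (s : state n) (D : {set {set 'I_n}})
    : bool :=
  (D \subset free_edges s) && (#|D| == minn b #|free_edges s|).

Definition breaker_move (n : nat) (s : state n) (D : {set {set 'I_n}})
    : state n :=
  State Walker (pos s) (walker_edges s) (D :|: breaker_edges s).

(* The argument is the list of all states so far, oldest first, ending with
   the current one; the value is the vertex Walker moves to. *)
Definition walker_strategy (n : nat) := seq (state n) -> 'I_n.

(* If the strategy proposes an illegal move (in particular if Walker is stuck)
   the game stops: the state stays the same forever. *)
Definition next_state (n b : nat) (S : walker_strategy n) (h : seq (state n))
    (s s' : state n) : Prop :=
  match to_move s with
  | Walker => s' = if walker_legal s (S h) then walker_move s (S h) else s
  | Breaker => exists2 D, breaker_legal b s D & s' = breaker_move s D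
  end.

Definition play (n b : nat) (first : player) (v0 : 'I_n)
    (S : walker_strategy n) (p : nat -> state n) : Prop :=
  p 0 = State first v0 set0 set0 /\
  forall i : nat, next_state b S (mkseq p i.+1) (p i) (p i.+1).

Definition is_cycle (n : nat) (E : {set {set 'I_n}}) (c : seq 'I_n) : Prop :=
  2 < size c /\ ucycle (fun u v => [set u; v] \in E) c.

Definition walker_can_create_cycle (n b : nat) (first : player) (v0 : 'I_n)
    (good_length : nat -> Prop) : Prop :=
  exists S : walker_strategy n,
    forall p : nat -> state n, play b first v0 S p ->
      exists (i : nat) (c : seq 'I_n),
        is_cycle (walker_edges (p i)) c /\ good_length (size c).

(* Main.v *)
(* Walker maintains a path ending at her position. In her O(n) moves Breaker
   claims O(bn) edges, so only O(b) vertices ever reach Breaker-degree n/4, and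
   for any set S of at least 128b vertices only few vertices can be joined by
   Breaker to half of S. Hence a Posa rotation followed by a step along the path
   brings Walker to a path end with many unclaimed edges to S. With S the set
   of unvisited vertices this extends the path until at most 128b vertices
   remain; with S the first 128b vertices of the path it then closes a cycle. *)

Require Import Defs.
From mathcomp Require Import all_boot zify.
From mathcomp Require boolp.

Set Implicit Arguments.
Unset Strict Implicit.
Unset Printing Implicit Defensive.

(* Some cardinals carry a [reverse_coercion] left by elaboration, which hides
   that they are equal from lia. *)
Ltac card_lia := unfold reverse_coercion in *; lia.

(** * Forcing a goal in boundedly many moves, and strategies from it *)

Section Forcing.

Variables n b : nat.
Implicit Types (Q : state n -> Prop) (s : state n).

(** Bounded unfolding of the game tree: [k] counts the moves of both players and is only an upper
    bound, as [Q] may hold earlier. *)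
Fixpoint force Q (k : nat) s : Prop :=
  if k is k'.+1 then
    Q s \/ match to_move s with
           | Walker => exists2 w, walker_legal s w & force Q k' (walker_move s w)
           | Breaker =>
               forall D, breaker_legal b s D -> force Q k' (breaker_move s D)
           end
  else Q s.

Lemma force_now Q k s : Q s -> force Q k s.
Proof. by case: k => //= k; left. Qed.

Lemma force_bind Q Q' k m s :
  (forall s', Q s' -> force Q' m s') -> force Q k s -> force Q' (m + k) s.
Proof.
move=> QQ'.
(* Reaching [Q] early leaves some of the [k] moves unspent; [mono] absorbs them. *)
have mono j i : forall s', force Q' i s' -> force Q' (i + j) s'.
  elim: i => [|i IHi] s' /=; first exact: force_now.
  case=> [?|]; first by left.
  case: (to_move s') => [[w lw fw]|fD]; right; first by exists w => //; apply: IHi.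
  by move=> D /fD; apply: IHi.
elim: k s => [|k IHk] s /=; first by rewrite addn0; apply: QQ'.
case=> [/QQ' fs|]; first exact: mono.
rewrite addnS /=; case: (to_move s) => [[w lw fw]|fD]; right.
  by exists w => //; apply: IHk.
by move=> D /fD; apply: IHk.
Qed.

(* The positional strategy picks a move that decreases the least number of
   moves within which the goal can be forced. *)
Lemma force_strategy Q k s0 :
  force Q k s0 ->
  exists S : walker_strategy n,
    forall p, p 0 = s0 ->
      (forall i, next_state b S (mkseq p i.+1) (p i) (p i.+1)) ->
      exists i, Q (p i).
Proof.
move=> f0.
pose move_ok s w := boolp.asbool (walker_legal s w /\
  exists2 m, force Q m (walker_move s w) &
    forall j, force Q j s -> m < j).
(* The default, a loop at the current vertex, is illegal; it is never proposed at a Walker turn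
   where the goal is forceable but not yet reached. *)
exists (fun h => odflt (pos (last s0 h)) [pick w | move_ok (last s0 h) w]).
move=> p p0 step.
suff win m : forall i, force Q m (p i) -> exists i, Q (p i).
  by apply: (win k 0); rewrite p0.
elim/ltn_ind: m => m IHm i fm.
have exm : exists j, boolp.asbool (force Q j (p i)).
  by exists m; apply/boolp.asboolP.
case: (ex_minnP exm) => [[|j]] /boolp.asboolP fj minj; first by exists i.
have ltjm : j < m by apply: minj; apply/boolp.asboolP.
case: fj => [Qi|]; first by exists i.
have lastE : last s0 (mkseq p i.+1) = p i.
  by rewrite (last_nth s0) size_mkseq -[RHS](nth_mkseq s0 p (ltnSn i)).
move: (step i); rewrite /next_state lastE.
case: (to_move (p i)) => [es|[D lD eD]] fj; last first.
  by apply: (IHm j ltjm i.+1); rewrite eD; apply: fj.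
move: es; case: pickP => [w /boolp.asboolP[lw [m' fm' ltm']]|none] /= es.
  apply: (IHm m' (ltm' _ fm) i.+1).
  by rewrite es lw.
case: fj => w lw fw; case/negP: (none w); apply/boolp.asboolP; split=> //.
by exists j => // j' fj'; apply: minj; apply/boolp.asboolP.
Qed.

Record round s (w : 'I_n) (s' : state n) : Prop := Round {
  round_to_move : to_move s' = Walker;
  round_pos : pos s' = w;
  round_walker : walker_edges s' = [set pos s; w] |: walker_edges s;
  round_breaker : exists2 D, breaker_edges s' = D :|: breaker_edges s & #|D| <= b;
  round_disjoint : [disjoint walker_edges s & breaker_edges s] ->
    [disjoint walker_edges s' & breaker_edges s'] }.

Lemma force_round Q k s w :
  to_move s = Walker -> walker_legal s w ->
  (forall s', round s w s' -> force Q k s') -> force Q k.+2 s.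
Proof.
move=> tm lw H /=; right; rewrite tm; exists w => //; right=> /= D.
rewrite /breaker_legal /= => /andP[/subsetP sD /eqP cD].
apply: H; split=> //=; first by exists D => //; rewrite cD geq_minl.
rewrite ![[disjoint _ & _]]disjoint_subset => /subsetP dis.
apply/subsetP => e; rewrite !inE negb_or => /orP he.
apply/andP; split.
  apply/negP => /sD; rewrite !inE /= negb_or.
  by case: he => ->; rewrite ?orbT.
case: he => [/eqP ->|/dis]; last by rewrite inE.
by case/andP: lw.
Qed.

End Forcing.

(** * Breaker-degree counts and pigeonhole arguments *)

Section BreakerDegree.

Variable n : nat.
Implicit Types (S : {set 'I_n}) (B : {set {set 'I_n}}).

Definition nbhd B S v : {set 'I_n} := [set w in S | [set v; w] \in B].

Lemma set2_injr (T : finType) (u : T) : injective (fun w => [set u; w]).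
Proof.
move=> w w' /= /setP E; move: (E w) (E w'); rewrite !inE !eqxx !orbT.
case/esym/orP => [/eqP->|/eqP //] /orP [/eqP-> //|/eqP->] //.
Qed.

Lemma nbhdU B D S v : #|nbhd (D :|: B) S v| <= #|nbhd B S v| + #|D|.
Proof.
have sub : nbhd (D :|: B) S v \subset
    nbhd B S v :|: [set w | [set v; w] \in D].
  apply/subsetP => w; rewrite !inE => /andP[-> /orP[->|->]] //.
  by rewrite orbT.
apply: leq_trans (subset_leq_card sub) _.
apply: leq_trans (leq_card_setU _ _) _; rewrite leq_add2l.
rewrite -(card_imset _ (@set2_injr _ v)); apply: subset_leq_card.
by apply/subsetP => e /imsetP[w]; rewrite inE => hw ->.
Qed.

(** Double counting: a given set is [[set v; w]] for at most two ordered pairs [(v, w)]. *)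
Lemma sum_nbhd B S : \sum_v #|nbhd B S v| <= 2 * #|B|.
Proof.
have card_pairs (e : {set 'I_n}) : \sum_v \sum_w ([set v; w] == e) <= 2.
  rewrite pair_big /=.
  rewrite (eq_bigr (fun p => if [set p.1; p.2] == e then 1 else 0)); last first.
    by move=> p _; case: eqP.
  rewrite -big_mkcond sum1_card.
  case: (pickP (fun p : 'I_n * 'I_n => [set p.1; p.2] == e)) => [[a c] /= /eqP ac|none].
    apply: (@leq_trans #|[set (a, c); (c, a)]|); last by rewrite cards2; case: eqP.
    apply/subset_leq_card/subsetP => [[v w]] vwe.
    have E : [set v; w] = [set a; c] by rewrite ac; apply/eqP.
    rewrite !inE.
    have: v \in [set a; c] by rewrite -E !inE eqxx.
    rewrite !inE => /orP[]/eqP vE; move: E; rewrite vE.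
      by move/(@set2_injr _ a)->; rewrite eqxx.
    by rewrite [RHS]setUC => /(@set2_injr _ c)->; rewrite eqxx orbT.
  by rewrite eq_card0 // => p; rewrite !inE.
apply: (@leq_trans (\sum_(e in B) \sum_v \sum_w ([set v; w] == e))); last first.
  by rewrite mulnC -sum_nat_const; apply: leq_sum.
rewrite exchange_big /=; apply: leq_sum => v _.
rewrite exchange_big /= -sum1_card big_mkcond /=; apply: leq_sum => w _.
rewrite inE; case: ifP => // /andP[_ hB].
by rewrite (bigD1 [set v; w]) //= eqxx.
Qed.

(** Markov's inequality for the degree sum; [c] expresses the threshold [m / c] without division. *)
Lemma card_high_degree B S c m :
  #|[set v | m <= c * #|nbhd B S v|]| * m <= 2 * c * #|B|.
Proof.
rewrite -sum_nat_const [2 * c]mulnC -mulnA.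
apply: (@leq_trans (c * \sum_v #|nbhd B S v|)); last first.
  by rewrite leq_mul2l sum_nbhd orbT.
rewrite big_distrr /= [X in _ <= X](bigID (mem [set v | m <= c * #|nbhd B S v|])) /=.
apply: leq_trans (leq_addr _ _); apply: leq_sum => v.
by rewrite inE.
Qed.

Lemma card_high_degree_leq B b :
  0 < n -> #|B| <= 4 * b * n ->
  #|[set u | n <= 4 * #|nbhd B [set: 'I_n] u|]| <= 32 * b.
Proof.
move=> n_gt0 leB; rewrite -(leq_pmul2r n_gt0).
apply: leq_trans (card_high_degree _ _ 4 n) _.
by rewrite -[32]/(2 * 4 * 4) -!mulnA !leq_pmul2l // mulnA.
Qed.

Lemma card_high_degree_in_leq B (S : {set 'I_n}) b :
  0 < b -> #|B| <= 4 * b * n -> 128 * b <= #|S| ->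
  8 * #|[set y | #|S| <= 2 * #|nbhd B S y|]| <= n.
Proof.
move=> b_gt0 leB leS; set X := #|_|.
(* Threshold |S|/2 gives X|S| <= 16bn, and the constant 128 turns this into X <= n/8. *)
have : X * (128 * b) <= 2 * 2 * (4 * b * n).
  apply: leq_trans (leq_mul (leqnn _) leS) _.
  by apply: leq_trans (card_high_degree _ _ 2 _) _; rewrite leq_mul2l leB.
by move: X => X; nia.
Qed.

End BreakerDegree.

(** Pigeonhole on the [size l] consecutive pairs of [y :: l]: an entry satisfying [a] spoils at most
    the pair it ends, one satisfying [c] at most the pair it starts. *)
Lemma adjacent_pair (T : Type) (a c : pred T) y l :
  count a l + count c (y :: l) < size l ->
  exists A y' x Z, [/\ y :: l = A ++ y' :: x :: Z, ~~ a x & ~~ c y'].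
Proof.
elim: l y => //= x l IHl y lt.
case ax: (a x); last first.
  case cy: (c y); last by exists [::], y, x, l; rewrite ax cy.
  have [|A [y' [x' [Z [-> ? ?]]]]] := IHl x; last by exists (y :: A), y', x', Z.
  by move: lt; rewrite ax cy /=; lia.
have [|A [y' [x' [Z [-> ? ?]]]]] := IHl x; last by exists (y :: A), y', x', Z.
by move: lt; rewrite ax /=; lia.
Qed.

Lemma count_uniq_leq (T : finType) (A : {set T}) (l : seq T) :
  uniq l -> count (mem A) l <= #|A|.
Proof.
move=> ul; rewrite -size_filter -(card_uniqP (filter_uniq _ ul)).
by apply/subset_leq_card/subsetP => x; rewrite mem_filter => /andP[].
Qed.

Lemma cards_nonempty_diff (T : finType) (S X Y : {set T}) :
  #|X| + #|Y| < #|S| -> exists u, [/\ u \in S, u \notin X & u \notin Y].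
Proof.
move=> lt; have /subsetPn[u uS] : ~~ (S \subset X :|: Y).
  apply/negP => /subset_leq_card le.
  by have := leq_trans le (leq_card_setU _ _); lia.
by rewrite inE negb_or => /andP[? ?]; exists u.
Qed.

(** * Extending and rotating the path, and closing the cycle *)

Section Game.

Variables n b : nat.
Implicit Types (s : state n) (P : seq 'I_n).

Definition adj s : rel 'I_n := fun x y => [set x; y] \in walker_edges s.

(** The [4 * b] in the degree bound pays for Breaker's reply after Walker enters a vertex of
    Breaker-degree below n/4. *)
Record good s (t : nat) : Prop := Good {
  good_to_move : to_move s = Walker;
  good_disjoint : [disjoint walker_edges s & breaker_edges s];
  good_breaker : #|breaker_edges s| <= t;
  good_degree : 4 * #|nbhd (breaker_edges s) [set: 'I_n] (pos s)| <= n + 4 * b }.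

Lemma adj_sym s x y : adj s x y = adj s y x.
Proof. by rewrite /adj setUC. Qed.

Lemma edge_legal s w :
  pos s != w -> [set pos s; w] \notin breaker_edges s -> walker_legal s w.
Proof. by move=> d nB; rewrite /walker_legal nB inE cards2 d. Qed.

Lemma adj_legal s w :
  [disjoint walker_edges s & breaker_edges s] ->
  pos s != w -> adj s (pos s) w -> walker_legal s w.
Proof. by move=> dis d a; apply: edge_legal => //; rewrite (disjointFr dis a). Qed.

Section Round.

Variables (s s' : state n) (w : 'I_n).
Hypothesis r : round b s w s'.

Lemma round_adj : subrel (adj s) (adj s').
Proof. by move=> x y; rewrite /adj (round_walker r) inE => ->; rewrite orbT. Qed.

Lemma round_adj_new : adj s' (pos s) w.
Proof. by rewrite /adj (round_walker r) setU11. Qed.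

Lemma round_card_breaker : #|breaker_edges s'| <= #|breaker_edges s| + b.
Proof.
have [D -> leD] := round_breaker r.
by apply: leq_trans (leq_card_setU _ _) _; lia.
Qed.

Lemma round_nbhd S v :
  #|nbhd (breaker_edges s') S v| <= #|nbhd (breaker_edges s) S v| + b.
Proof.
have [D -> leD] := round_breaker r.
by apply: leq_trans (nbhdU _ _ _ _) _; rewrite leq_add2l.
Qed.

Lemma round_good t :
  [disjoint walker_edges s & breaker_edges s] -> #|breaker_edges s| <= t ->
  4 * #|nbhd (breaker_edges s) [set: 'I_n] w| < n -> good s' (t + b).
Proof.
move=> dis leB deg; split.
- exact: round_to_move r.
- exact: (round_disjoint r).
- by have := round_card_breaker; lia.
- by rewrite (round_pos r); have := round_nbhd [set: 'I_n] w; lia.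
Qed.

End Round.

(** Paths are listed from Walker's end. [P1] may be reordered, [P2] stays fixed, and [u] may lie in
    [P2], which is how the cycle gets closed. *)
Definition reaches (P1 P2 : seq 'I_n) (S : {set 'I_n}) t s' : Prop :=
  exists P u, [/\ perm_eq P P1, u \in S, pos s' = u,
    sorted (adj s') (u :: P ++ P2) & good s' t].

Lemma good_leq s t t' : t <= t' -> good s t -> good s t'.
Proof. by move=> le [? ? leB ?]; split=> //; apply: leq_trans le. Qed.

(** One direct step suffices: more than n/2 vertices are unvisited, while at most n/4 + b are
    Breaker-neighbours of [v] and at most 32b have Breaker-degree n/4 or more. *)
Lemma force_extension s v l t :
  good s t -> pos s = v -> sorted (adj s) (v :: l) -> uniq (v :: l) ->
  t <= 4 * b * n -> 2 * (size l).+1 < n -> 512 * b <= n ->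
  force b (reaches (v :: l) [::] (~: [set x in v :: l]) (t + b)) 2 s.
Proof.
move=> gs vE sP uP le_t ltP le_b.
have [tm dis leB deg] := gs.
pose B := breaker_edges s.
pose high := [set u | n <= 4 * #|nbhd B [set: 'I_n] u|].
have high32 : #|high| <= 32 * b.
  by apply: card_high_degree_leq; [lia | apply: leq_trans le_t].
have cP : #|[set x in v :: l]| = (size l).+1.
  by rewrite cardsE (card_uniqP uP).
have [|u [uS uhigh uB]] := @cards_nonempty_diff _
    (~: [set x in v :: l]) high (nbhd B [set: 'I_n] v).
  have degB : 4 * #|nbhd B [set: 'I_n] v| <= n + 4 * b by rewrite -vE.
  by have := cardsC [set x in v :: l]; rewrite cP card_ord; card_lia.
have uP' : u \notin v :: l by move: uS; rewrite !inE.
apply: (@force_round _ _ _ _ _ u tm).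
  apply: edge_legal; first by apply: contraNneq uP' => <-; rewrite vE mem_head.
  by move: uB; rewrite !inE vE.
move=> s1 r1; exists (v :: l), u; split=> //; first exact: round_pos r1.
  rewrite cats0 /= adj_sym -vE (round_adj_new r1) /=.
  by rewrite vE; apply: sub_path sP; apply: round_adj r1.
by apply: (round_good r1); move: uhigh; rewrite // inE -ltnNge.
Qed.

(* Rotation: if y, x are consecutive on the path v ... y x ... then claiming vx
   and returning along the path edge xy leaves Walker at the end y of the path
   y ... v x ..., on the same vertices. The end y can be chosen among linearly
   many vertices, while Breaker has too few edges for all of these to have many
   neighbours in S. *)
Lemma force_rotation s v l P2 (S : {set 'I_n}) t :
  good s t -> pos s = v -> sorted (adj s) ((v :: l) ++ P2) -> uniq (v :: l) ->
  t + 3 * b <= 4 * b * n -> n <= 2 * (size l).+1 -> 0 < b -> 512 * b <= n ->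
  128 * b <= #|S| -> {in S, forall u, u \notin v :: l} ->
  force b (reaches (v :: l) P2 S (t + 3 * b)) 6 s.
Proof.
move=> gs vE sP uP le_t geP b_gt0 le_b leS SP.
have n_gt0 : 0 < n by lia.
have [tm dis leB deg] := gs.
pose high := [set y | #|S| <= 2 * #|nbhd (breaker_edges s) S y|].
have high8 : 8 * #|high| <= n.
  apply: (@card_high_degree_in_leq _ _ _ b) => //.
  by apply: leq_trans leB _; lia.
(* Of at least n/2 - 1 consecutive pairs, at most n/4 + b are lost to Breaker-neighbours of [v] and
   at most n/8 to [high]. *)
have [|A [y [x [Z [lE xN yhigh]]]]] := @adjacent_pair 'I_n
    (mem (nbhd (breaker_edges s) [set: 'I_n] v)) (mem high) v l.
  have ul : uniq l by case/andP: uP.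
  apply: leq_ltn_trans (leq_add (count_uniq_leq _ ul) (count_uniq_leq _ uP)) _.
  by move: deg high8; rewrite vE; card_lia.
have xl : x \in v :: l by rewrite lE mem_cat !inE eqxx !orbT.
have yl : y \in v :: l by rewrite lE mem_cat !inE eqxx !orbT.
have headAy : exists A', rcons A y = v :: A'.
  case: (A) lE => [|a A'] /= [<- _]; first by exists [::].
  by exists (rcons A' y).
have uP' : uniq (rcons A y ++ x :: Z) by rewrite cat_rcons -lE.
have [A' AyE] := headAy.
have vx : v != x.
  move: uP'; rewrite AyE /= => /andP[+ _].
  by rewrite mem_cat inE !negb_or => /and3P[].
have xy : x != y.
  move: uP; rewrite lE cat_uniq /= => /and3P[_ _ /andP[+ _]].
  by rewrite inE negb_or eq_sym => /andP[].
apply: (@force_round _ _ _ _ _ x tm).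
  by apply: edge_legal; rewrite vE //; move: xN; rewrite !inE.
move=> s1 r1.
have sP1 := sub_sorted (round_adj r1) sP.
have adj_yx : adj s1 y x.
  move: sP1; rewrite lE -catA -cat_rcons AyE /= cat_path => /andP[_] /=.
  have -> : last v A' = y by rewrite -(last_rcons v A y) AyE.
  by case/andP.
have dis1 := round_disjoint r1 dis.
apply: (@force_round _ _ _ _ _ y (round_to_move r1)).
  by apply: adj_legal => //; rewrite (round_pos r1) // adj_sym.
move=> s2 r2.
have dis2 := round_disjoint r2 dis1.
pose B2 := breaker_edges s2.
have leB2 : #|B2| <= t + 2 * b.
  rewrite mul2n -addnn addnA; apply: leq_trans (round_card_breaker r2) _.
  by rewrite leq_add2r; apply: leq_trans (round_card_breaker r1) _; rewrite leq_add2r.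
pose high2 := [set u | n <= 4 * #|nbhd B2 [set: 'I_n] u|].
have high32 : #|high2| <= 32 * b.
  apply: card_high_degree_leq => //.
  by apply: leq_trans leB2 _; move: le_t b_gt0; clear; lia.
(* After two replies [y] has fewer than |S|/2 + 2b Breaker-neighbours in [S]; adding the 32b
   vertices of [high2] stays below |S|, as |S| >= 128b. *)
have [|u [uS uhigh uB]] := @cards_nonempty_diff _ S high2 (nbhd B2 S y).
  have arith h d d' m : 0 < b -> h <= 32 * b -> 128 * b <= m -> 2 * d < m ->
      d' <= d + b + b -> h + d' < m by clear; lia.
  apply: (arith _ #|nbhd (breaker_edges s) S y| _ _ b_gt0 high32 leS); last first.
    by apply: leq_trans (round_nbhd r2 S y) _; rewrite leq_add2r; exact: (round_nbhd r1).
  by move: yhigh; rewrite /= inE -ltnNge.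
have uP1 := SP u uS.
have yu : y != u by apply: contraNneq uP1 => <-.
apply: (@force_round _ _ _ _ _ u (round_to_move r2)).
  by apply: edge_legal; rewrite (round_pos r2) //; move: uB; rewrite inE uS.
(* The segment from [v] to [y] is reversed: the path is now u, y ... v, x, Z, with vx claimed in the
   first round and yu in the third. *)
move=> s3 r3; exists (rev (rcons A y) ++ x :: Z), u; split=> //.
- by rewrite lE -[A ++ _]cat_rcons perm_cat2r perm_rev.
- exact: round_pos r3.
- have adj_uy : adj s3 u y by rewrite adj_sym -(round_pos r2) (round_adj_new r3).
  have adj_vx : adj s3 v x.
    by apply/(round_adj r3)/(round_adj r2); rewrite -vE (round_adj_new r1).
  have := sub_sorted (round_adj r3) (sub_sorted (round_adj r2) sP1).
  rewrite lE -[A ++ _]cat_rcons -!catA AyE /= cat_path => /andP[pA /= /andP[_ pZ]].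
  have revE : rev (v :: A') = y :: behead (rev (v :: A')).
    by rewrite -AyE rev_rcons.
  have lastE : last y (behead (rev (v :: A'))) = v.
    by rewrite -[LHS]/(last y (y :: behead (rev (v :: A')))) -revE rev_cons last_rcons.
  have srev : sorted (adj s3) (rev (v :: A')).
    rewrite rev_sorted /=; apply: sub_path pA => i j.
    by rewrite adj_sym.
  move: srev; rewrite revE /= cat_path => -> /=.
  by rewrite adj_uy lastE adj_vx.
- have -> : t + 3 * b = t + 2 * b + b by clear; lia.
  by apply: (round_good r3); move: uhigh; rewrite // inE -ltnNge.
Qed.

Definition has_cycle m s : Prop :=
  exists c, is_cycle (walker_edges s) c /\ m <= size c.

(** The oldest 128b path vertices form the fixed tail [P2]; rotating the other n - 256b vertices
    leads Walker back into [P2]. *)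
Lemma force_close s v l :
  good s (3 * b * (size l).+1) -> pos s = v -> sorted (adj s) (v :: l) ->
  uniq (v :: l) -> (size l).+1 + 128 * b = n -> 0 < b -> 512 * b <= n ->
  force b (has_cycle (n - 256 * b)) 6 s.
Proof.
move=> gs vE sP uP sz b_gt0 le_b.
pose k := size l - 128 * b.
pose P2 := drop k l.
have P2E : size P2 = 128 * b by rewrite size_drop /k; lia.
have kE : k.+1 + 256 * b = n by rewrite /k; lia.
have tE : size (take k l) = k by rewrite size_takel // /k; lia.
have lE : take k l ++ P2 = l := cat_take_drop k l.
have uPP : uniq ((v :: take k l) ++ P2) by rewrite /= lE.
have [uP1 [disP uP2]] : uniq (v :: take k l) /\
    ~~ has (mem (v :: take k l)) P2 /\ uniq P2.
  by move: uPP; rewrite cat_uniq => /and3P[].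
rewrite -[6]/(0 + 6).
apply: (@force_bind _ _ (reaches (v :: take k l) P2 [set x in P2]
   (3 * b * (size l).+1 + 3 * b))).
  move=> s' [P [u [permP]]]; rewrite inE => uP2' posu.
  case/splitPr: uP2' uPP => A Z uPP sP' gs' /=.
  have sizeP := perm_size permP; rewrite /= tE in sizeP.
  (* The walk [u :: P ++ A ++ u :: Z] meets [u] twice; the part in between is the cycle, and it
     contains all of [P]. *)
  exists (u :: P ++ A); rewrite /is_cycle /= size_cat sizeP.
  split; last by move: (size A) kE; clear; lia.
  split; first by move: kE b_gt0 le_b; clear; lia.
  apply/andP; split.
    move: sP'; rewrite /= catA -cat_rcons cat_path => /andP[].
    by rewrite rcons_cat.
  have: uniq (P ++ (A ++ u :: Z)).
    by rewrite (perm_uniq (s2 := (v :: take k l) ++ (A ++ u :: Z))) ?perm_cat2r.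
  rewrite catA cat_uniq => /and3P[uPA /= + _].
  by rewrite negb_or uPA andbT => /andP[].
apply: (@force_rotation s v) => //=; rewrite ?tE ?lE //.
- by nia.
- by rewrite /k; lia.
- by rewrite cardsE (card_uniqP uP2) P2E.
- move=> u; rewrite inE => uP2'; apply: contra disP => uin.
  by apply/hasP; exists u.
Qed.

(** Each of the [m] vertices to be added costs at most three rounds: six moves and 3b Breaker edges.
    The total stays within the 4bn edges allowed by the degree counts. *)
Lemma force_path s v l m :
  good s (3 * b * (size l).+1) -> pos s = v -> sorted (adj s) (v :: l) ->
  uniq (v :: l) -> m + (size l).+1 + 128 * b = n -> 0 < b -> 512 * b <= n ->
  force b (has_cycle (n - 256 * b)) (6 + 6 * m) s.
Proof.
move=> gs vE sP uP sz b_gt0 le_b.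
have le_t p : p + 128 * b < n -> 3 * b * p + 3 * b <= 4 * b * n.
  by move=> ltp; rewrite -mulnSr !leq_mul //; lia.
elim: m => [|m IHm] in s v l gs vE sP uP sz *.
  exact: (@force_close s v l).
have -> : 6 + 6 * m.+1 = (6 + 6 * m) + 6 by lia.
apply: (@force_bind _ _ (reaches (v :: l) [::] (~: [set x in v :: l])
   (3 * b * (size l).+1 + 3 * b))).
  move=> s' [P [u [permP uS posu]]]; rewrite cats0 => sP' gs'.
  have szP := perm_size permP; rewrite /= in szP.
  apply: (IHm s' u P) => //=.
  - by apply: good_leq gs'; rewrite szP; lia.
  - by rewrite (perm_mem permP) (perm_uniq permP); move: uS; rewrite !inE => ->.
  - by rewrite szP; lia.
have [ltP|geP] := ltnP (2 * (size l).+1) n; last first.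
  apply: force_rotation => //; rewrite ?cats0 //; first by apply: le_t; lia.
    have := cardsC [set x in v :: l]; rewrite cardsE (card_uniqP uP) card_ord /=.
    by card_lia.
  by move=> u; rewrite !inE.
rewrite -[6]/(4 + 2); apply: force_bind; last first.
  apply: (@force_extension s v l (3 * b * (size l).+1)) => //.
  apply: (@leq_trans (3 * b * (size l).+1 + 3 * b)); first exact: leq_addr.
  by apply: le_t; lia.
move=> s' [P [u [? ? ? ? g]]]; apply: force_now; exists P, u; split=> //.
by apply: good_leq g; lia.
Qed.

Lemma force_start first (v0 : 'I_n) :
  0 < b -> 512 * b <= n ->
  exists k, force b (has_cycle (n - 256 * b)) k (State first v0 set0 set0).
Proof.
move=> b_gt0 le_b.
pose m := n - 1 - 128 * b.
(* [B] is empty if Walker starts, and Breaker's opening move otherwise. *)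
have start (B : {set {set 'I_n}}) : #|B| <= b ->
    force b (has_cycle (n - 256 * b)) (6 + 6 * m) (State Walker v0 set0 B).
  move=> leB; apply: (@force_path _ v0 [::]) => //=; last by rewrite /m; lia.
  split=> //=; first by rewrite disjoints_subset sub0set.
    by apply: leq_trans leB _; lia.
  apply: (@leq_trans (4 * b)); last exact: leq_addl.
  rewrite leq_pmul2l // -(setU0 B); apply: leq_trans (nbhdU _ _ _ _) _.
  by rewrite eq_card0 // => w; rewrite !inE andbF.
case: first; first by exists (6 + 6 * m); apply: start; rewrite cards0.
exists (6 + 6 * m).+1; right=> D /andP[_ /eqP cD].
by rewrite /breaker_move setU0; apply: start; rewrite cD geq_minl.
Qed.

End Game.

(* The logarithmic bias condition and the final constants *)
From mathcomp Require Import all_order all_algebra.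
From mathcomp Require Import all_classical all_reals all_analysis.
Import Order.TTheory GRing.Theory Num.Theory.
Local Open Scope ring_scope.

(** For n > e^32 the squared logarithm is at least 32^2 = 1024, hence at least 512. *)
Lemma bias_leq (R : realType) (n b : nat) :
  (Num.truncn (expR 32 : R) < n)%N ->
  b%:R <= n%:R / ln (n%:R : R) ^+ 2 -> (512 * b <= n)%N.
Proof.
move=> lt_n le_b.
have e_gt0 : 0 < expR 32 :> R := expR_gt0 _.
have e_lt : expR 32 < n%:R :> R by apply: lt_le_trans (truncnS_gt _) _; rewrite ler_nat.
have n_gt0 : 0 < n%:R :> R := lt_trans e_gt0 e_lt.
have ln_n : 32 <= ln (n%:R : R).
  by rewrite -[X in X <= _]expRK ler_ln ?posrE // ltW.
have ln2 : 512 <= ln (n%:R : R) ^+ 2.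
  apply: (@le_trans _ _ (32 ^+ 2)); last first.
    by rewrite ler_sqr ?nnegrE // (le_trans _ ln_n).
  by rewrite -natrX ler_nat.
rewrite -(ler_nat R) natrM mulrC -ler_pdivlMr ?ltr0n //.
apply: le_trans le_b _; rewrite ler_pM2l // lef_pV2 ?posrE ?ltr0n //.
exact: lt_le_trans ln2.
Qed.

Theorem theorem1p2 (R : realType) :
  exists C : R, 0 < C /\
    exists n0 : nat, forall n b : nat,
      (n0 <= n)%N -> (0 < n)%N -> (0 < b)%N ->
      b%:R <= n%:R / ln (n%:R : R) ^+ 2 ->
      forall (first : player) (v0 : 'I_n),
        walker_can_create_cycle b first v0
          (fun l : nat => n%:R - C * b%:R <= l%:R).
Proof.
(* 128b vertices stay off the path, and fewer than 128b more are cut off when the cycle closes. *)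
exists 256; split; first by rewrite ltr0n.
exists (Num.truncn (expR 32 : R)).+1 => n b le_n _ b_gt0 le_b first v0.
have [k fk] := force_start first v0 b_gt0 (bias_leq le_n le_b).
have [S SP] := force_strategy fk.
exists S => p [p0 step].
have [i [c [cyc le_c]]] := SP p p0 step.
exists i, c; split=> //.
by rewrite lerBlDr -natrM -natrD ler_nat addnC -leq_subLR.
Qed.
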